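(* Let $\hat m,\hat n\in S^2$ with $\hat m^{\mathrm T}\hat n\in[0,1)$, and put $\delta=\arccos \hat m^{\mathrm T}\hat n\in(0,\pi/2]$ and $\hat l=\|\hat m\times\hat n\|^{-1}\,\hat m\times\hat n$. For $\alpha,\gamma\in\mathbb R$ and $\beta\in[0,\pi]$ put $$U_{\alpha,\beta,\gamma}^{\hat m,\hat l}:=R_{\hat m}(\alpha)R_{\hat l}(\beta)R_{\hat m}(\gamma).$$ Then for any $\alpha,\gamma\in\mathbb R$ and $\beta\in[0,\pi]$, if $$b(\hat m,U_{\alpha,\beta,\gamma}^{\hat m,\hat l})\ \ge\ b(\hat n,U_{\alpha,\beta,\gamma}^{\hat m,\hat l}),$$ then $$N_{\hat m,\hat n}\big(F(U_{\alpha,\beta,\gamma}^{\hat m,\hat l})\big)=N_{\hat m,\hat n}(U_{\alpha,\beta,\gamma}^{\hat m,\hat l})=\min\Big\{2\Big\lceil\frac{\beta}{2\delta}\Big\rceil+1,\ g(\alpha,\beta,\delta),\ g(\gamma,-\beta,\delta)\Big\}.$$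
   Context: $\mathbb N$ is the set of strictly positive integers; $S^2=\{\hat v\in\mathbb R^3:\|\hat v\|=1\}$; $\arccos$ takes values in $[0,\pi]$. $I$ is the $2\times2$ identity matrix and $X=\begin{pmatrix}0&1\\1&0\end{pmatrix}$, $Y=\begin{pmatrix}0&-i\\i&0\end{pmatrix}$, $Z=\begin{pmatrix}1&0\\0&-1\end{pmatrix}$. For $\hat v=(v_x,v_y,v_z)^{\mathrm T}\in S^2$ and $\theta\in\mathbb R$, $$R_{\hat v}(\theta)=(\cos\tfrac\theta2)I-i(\sin\tfrac\theta2)(v_xX+v_yY+v_zZ)\in \mathrm{SU}(2).$$ $F:\mathrm{SU}(2)\to\mathrm{SO}(3)$ is the surjective homomorphism for which $F(U)(x,y,z)^{\mathrm T}=(x',y',z')^{\mathrm T}$, where $U(xX+yY+zZ)U^\dagger=x'X+y'Y+z'Z$. Put $\mathcal R_{\hat v}=\{R_{\hat v}(\theta):\theta\in\mathbb R\}$ and $\hat{\mathcal R}_{\hat v}=\{F(R_{\hat v}(\theta)):\theta\in\mathbb R\}$. For $U\in\mathrm{SU}(2)$, $N_{\hat m,\hat n}(U)$ is the least $j\in\mathbb N$ such that $U=V_1\cdots V_j$ for some $V_1,\dots,V_j\in\mathcal R_{\hat m}\cup\mathcal R_{\hat n}$. For $D\in\mathrm{SO}(3)$, $N_{\hat m,\hat n}(D)$ is the least $j\in\mathbb N$ such that $D=A_1\cdots A_j$ for some $A_1,\dots,A_j\in\hat{\mathcal R}_{\hat m}\cup\hat{\mathcal R}_{\hat n}$. Every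 $U\in\mathrm{SU}(2)$ is uniquely $U=wI+i(xX+yY+zZ)$ with $w,x,y,z\in\mathbb R$; for $\hat v\in S^2$, $b(\hat v,U):=|(x,y,z)\hat v|$. $f:\mathbb R^3\to[0,\pi]$ is $$f(\alpha,\beta,\delta)=2\arccos\sqrt{\cos^2\tfrac\beta2\cos^2\tfrac\delta2+\sin^2\tfrac\beta2\sin^2\tfrac\delta2+2\cos\alpha\,\sin\tfrac\beta2\sin\tfrac\delta2\cos\tfrac\beta2\cos\tfrac\delta2},$$ and $g:\mathbb R^2\times(0,\pi/2]\to\mathbb N$ is $g(\alpha,\beta,\delta)=2\big\lceil \frac{f(\alpha,\beta,\delta)}{2\delta}+\frac12\big\rceil$ if $f(\alpha,\beta,\delta)\ge\delta$, and $g(\alpha,\beta,\delta)=4$ otherwise. *)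

(* Defs.v *)
From HB Require Import structures.
From mathcomp Require Import all_boot all_order all_algebra spectral.
From mathcomp Require Import complex.
From mathcomp Require Import all_classical all_reals all_analysis.
From mathcomp Require Import ring.

Set Implicit Arguments.
Unset Strict Implicit.
Unset Printing Implicit Defensive.

Import Order.TTheory GRing.Theory Num.Theory.
Local Open Scope classical_set_scope.
Local Open Scope ring_scope.
Local Open Scope sesquilinear_scope.

Definition vec3 (R : realType) (x y z : R) : 'cV[R]_3 :=
  \col_i nth 0 [:: x; y; z] i.

Definition dot (R : realType) (u v : 'cV[R]_3) : R := (u^T *m v) 0 0.

(* The library's norm on matrices is the sup norm. *)
Definition norm2 (R : realType) (v : 'cV[R]_3) : R := Num.sqrt (dot v v).

Definition S2 (R : realType) : set 'cV[R]_3 := [set v | norm2 v = 1].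

Definition cross (R : realType) (u v : 'cV[R]_3) : 'cV[R]_3 :=
  vec3 (u 1 0 * v 2 0 - u 2 0 * v 1 0)
       (u 2 0 * v 0 0 - u 0 0 * v 2 0)
       (u 0 0 * v 1 0 - u 1 0 * v 0 0).

Definition mx2 (A : Type) (a b c d : A) : 'M[A]_2 :=
  \matrix_(i, j) nth a (nth [::] [:: [:: a; b]; [:: c; d]] i) j.

Definition pauliX (R : realType) : 'M[R[i]]_2 := mx2 0 1 1 0.
Definition pauliY (R : realType) : 'M[R[i]]_2 := mx2 0 (- 'i%C) 'i%C 0.
Definition pauliZ (R : realType) : 'M[R[i]]_2 := mx2 1 0 0 (- 1).

Definition pauli (R : realType) (v : 'cV[R]_3) : 'M[R[i]]_2 :=
  (v 0 0)%:C%C *: pauliX R + (v 1 0)%:C%C *: pauliY R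
    + (v 2 0)%:C%C *: pauliZ R.

(* Reads (x, y, z) off the entries of xX + yY + zZ
   = [[z, x - iy], [x + iy, -z]], see pauliK. *)
Definition pauli_coord (R : realType) (H : 'M[R[i]]_2) : 'cV[R]_3 :=
  vec3 (complex.Re (H 0 1)) (complex.Im (H 1 0)) (complex.Re (H 0 0)).

Definition SU2 (R : realType) : set 'M[R[i]]_2 :=
  [set U | U \is unitarymx /\ \det U = 1].

Definition rot (R : realType) (v : 'cV[R]_3) (theta : R) : 'M[R[i]]_2 :=
  (cos (theta / 2))%:C%C *: 1%:M - ('i%C * (sin (theta / 2))%:C%C) *: pauli v.

(* The covering SU(2) -> SO(3): column j holds the coordinates of
   U sigma_j U^dagger, see F_pauli. Only meaningful on SU2. *)
Definition F (R : realType) (U : 'M[R[i]]_2) : 'M[R]_3 :=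
  \matrix_(i, j) pauli_coord (U *m pauli (delta_mx j 0) *m U^t*) i 0.

(* (x, y, z) such that U = wI + i(xX + yY + zZ) with w real, for U in SU2;
   see SU2_im_vec and im_vec_unique. *)
Definition im_vec (R : realType) (U : 'M[R[i]]_2) : 'cV[R]_3 :=
  pauli_coord (- 'i%C *: U).

Definition b (R : realType) (v : 'cV[R]_3) (U : 'M[R[i]]_2) : R :=
  `|dot (im_vec U) v|.

Definition rots (R : realType) (v : 'cV[R]_3) : set 'M[R[i]]_2 :=
  range (rot v).

Definition rotsF (R : realType) (v : 'cV[R]_3) : set 'M[R]_3 :=
  range (fun theta : R => F (rot v theta)).

(* The least j >= 1 such that a is a product of j elements of S, and the junk
   value 0 if there is none. *)
Definition word_length (A : pzRingType) (S : set A) (a : A) : nat :=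
  let expressible j := (0 < j)%N /\
    exists V : 'I_j -> A, (forall k, S (V k)) /\ a = \prod_(k < j) V k in
  xget 0%N [set j | expressible j /\ forall k, expressible k -> (j <= k)%N].

Definition N_SU2 (R : realType) (m n : 'cV[R]_3) (U : 'M[R[i]]_2) : nat :=
  word_length (rots m `|` rots n) U.

Definition N_SO3 (R : realType) (m n : 'cV[R]_3) (D : 'M[R]_3) : nat :=
  word_length (rotsF m `|` rotsF n) D.

Definition f (R : realType) (alpha beta delta : R) : R :=
  2 * acos (Num.sqrt (
    cos (beta / 2) ^+ 2 * cos (delta / 2) ^+ 2
    + sin (beta / 2) ^+ 2 * sin (delta / 2) ^+ 2
    + 2 * cos alpha * sin (beta / 2) * sin (delta / 2)
        * cos (beta / 2) * cos (delta / 2))).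

(* int-valued, so that no truncation is involved. *)
Definition g (R : realType) (alpha beta delta : R) : int :=
  if delta <= f alpha beta delta
  then 2 * Num.ceil (f alpha beta delta / (2 * delta) + 1 / 2)
  else 4.

Definition Umat (R : realType) (m l : 'cV[R]_3) (alpha beta gamma : R) :
    'M[R[i]]_2 :=
  rot m alpha *m rot l beta *m rot m gamma.

Lemma mx2E (R : realType) (U : 'M[R[i]]_2) : U = mx2 (U 0 0) (U 0 1) (U 1 0) (U 1 1).
Proof.
apply/matrixP => i j; rewrite mxE.
by case: i j => [[|[|//]] ?] [[|[|//]] ?] /=; congr (U _ _); apply: val_inj.
Qed.

Lemma pauliE (R : realType) (v : 'cV[R]_3) : pauli v =
  mx2 (Complex (v 2 0) 0) (Complex (v 0 0) (- v 1 0))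
      (Complex (v 0 0) (v 1 0)) (Complex (- v 2 0) 0).
Proof.
apply/matrixP => i j; rewrite !mxE.
case: i j => [[|[|//]] ?] [[|[|//]] ?] /=; simpc;
  congr (Complex _ _); ring.
Qed.

Lemma pauliK (R : realType) (v : 'cV[R]_3) : pauli_coord (pauli v) = v.
Proof.
apply/matrixP => i j; rewrite pauliE ord1 /pauli_coord !mxE /=.
by case: i => [[|[|[|//]]] ?] /=; congr (v _ _); apply: val_inj.
Qed.

Lemma SU2_mx2 (R : realType) (U : 'M[R[i]]_2) : SU2 U -> exists a c : R[i], U = mx2 a (- c^*%C) c (a^*%C).
Proof.
move=> [Uu dU]; exists (U 0 0), (U 1 0).
have Uunit : U \in unitmx by apply: unitarymx_unit.
have := invmx_unitary Uu; rewrite /invmx Uunit dU invr1 scale1r => E.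
have E1 := congr1 (fun M : 'M[R[i]]_2 => M 0 0) E.
have E2 := congr1 (fun M : 'M[R[i]]_2 => M 0 1) E.
move: E1 E2; rewrite !mxE /cofactor !det_mx11 !mxE /= expr0 expr1 mul1r mulN1r.
have -> : lift 0 0 = 1 :> 'I_2 by apply: val_inj.
have -> : lift 1 0 = 0 :> 'I_2 by apply: val_inj.
move=> E1 E2; rewrite [LHS]mx2E E1; congr mx2.
by rewrite -[LHS]opprK E2.
Qed.

Lemma mul_mx2 (R : realType) (a b c d a' b' c' d' : R[i]) :
  mx2 a b c d *m mx2 a' b' c' d' =
  mx2 (a * a' + b * c') (a * b' + b * d') (c * a' + d * c') (c * b' + d * d').
Proof.
apply/matrixP => i j; rewrite !mxE !big_ord_recl big_ord0 addr0 !mxE.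
by case: i j => [[|[|//]] ?] [[|[|//]] ?].
Qed.

Lemma trmxC_mx2 (R : realType) (a b c d : R[i]) :
  (mx2 a b c d)^t* = mx2 (a^*%C) (c^*%C) (b^*%C) (d^*%C).
Proof.
apply/matrixP => i j; rewrite !mxE.
by case: i j => [[|[|//]] ?] [[|[|//]] ?].
Qed.

Definition conj_vec (R : realType) (p q r s : R) (v : 'cV[R]_3) : 'cV[R]_3 :=
  vec3
    ((p ^+ 2 - q ^+ 2 - r ^+ 2 + s ^+ 2) * v 0 0
       + 2 * (p * q - r * s) * v 1 0 + 2 * (p * r + q * s) * v 2 0)
    (- 2 * (p * q + r * s) * v 0 0
       + (p ^+ 2 - q ^+ 2 + r ^+ 2 - s ^+ 2) * v 1 0
       + 2 * (p * s - q * r) * v 2 0)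
    (- 2 * (p * r - q * s) * v 0 0 - 2 * (p * s + q * r) * v 1 0
       + (p ^+ 2 + q ^+ 2 - r ^+ 2 - s ^+ 2) * v 2 0).

Lemma conj_vecP (R : realType) (p q r s : R) (v : 'cV[R]_3) (U := mx2 (Complex p q) (Complex (- r) s)
    (Complex r s) (Complex p (- q))) :
  U *m pauli v *m U^t* = pauli (conj_vec p q r s v).
Proof.
rewrite /U trmxC_mx2 (pauliE v) !mul_mx2 pauliE /conj_vec ![vec3 _ _ _ _ _]mxE.
rewrite /nth /=; move: (v 0 0) (v 1 0) (v 2 0) => x y z.
by congr mx2; simpc; congr (Complex _ _); ring.
Qed.

Lemma F_pauli (R : realType) (U : 'M[R[i]]_2) (v : 'cV[R]_3) :
  SU2 U -> U *m pauli v *m U^t* = pauli (F U *m v).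
Proof.
move=> /SU2_mx2[[p q] [[r s] E]].
have {}E : U = mx2 (Complex p q) (Complex (- r) s) (Complex r s)
    (Complex p (- q)).
  by rewrite E; congr mx2; apply/eqP; rewrite eq_complex /= opprK !eqxx.
rewrite {1 2}E conj_vecP; congr pauli.
apply/matrixP => i j; rewrite ord1 [RHS]mxE.
have FE k : F U i k = conj_vec p q r s (delta_mx k 0) i 0.
  by rewrite mxE E conj_vecP pauliK.
rewrite (eq_bigr _ (fun k _ => congr1 (fun t => t * v k 0) (FE k))).
rewrite !big_ord_recl big_ord0.
have -> : lift 0 0 = 1 :> 'I_3 by apply: val_inj.
have -> : lift 0 (lift 0 0) = 2 :> 'I_3 by apply: val_inj.
rewrite !mxE.
by case: i {FE} => [[|[|[|//]]] ?] /=; ring.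
Qed.

Lemma SU2_im_vec (R : realType) (U : 'M[R[i]]_2) : SU2 U ->
  exists w : R, U = (w%:C%C)%:M + 'i%C *: pauli (im_vec U).
Proof.
move=> /SU2_mx2[[p q] [[r s] ->]]; exists p.
apply/matrixP => i j; rewrite pauliE !mxE /=.
case: i j => [[|[|//]] ?] [[|[|//]] ?] /=; simpc; congr (Complex _ _); ring.
Qed.

Lemma im_vec_unique (R : realType) (w : R) (v : 'cV[R]_3) :
  im_vec ((w%:C%C)%:M + 'i%C *: pauli v) = v.
Proof.
apply/matrixP => i j; rewrite ord1 pauliE !mxE /=.
case: i => [[|[|[|//]]] ?] /=; simpc; rewrite /= ?addr0 ?add0r;
  by congr (v _ _); apply: val_inj.
Qed.

Lemma rotE (R : realType) (v : 'cV[R]_3) (theta : R)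
    (c := cos (theta / 2)) (s := sin (theta / 2)) :
  rot v theta =
  mx2 (Complex c (- (s * v 2 0))) (Complex (- (s * v 1 0)) (- (s * v 0 0)))
      (Complex (s * v 1 0) (- (s * v 0 0))) (Complex c (s * v 2 0)).
Proof.
rewrite /rot pauliE; apply/matrixP => i j; rewrite !mxE -/c -/s.
by case: i j => [[|[|//]] ?] [[|[|//]] ?] /=; simpc; congr (Complex _ _); ring.
Qed.

Lemma rot_SU2 (R : realType) (v : 'cV[R]_3) (theta : R) :
  S2 v -> SU2 (rot v theta).
Proof.
move=> v1.
have {}v1 : v 0 0 ^+ 2 + v 1 0 ^+ 2 + v 2 0 ^+ 2 = 1.
  move: v1; rewrite /S2 /= /norm2 /dot mxE !big_ord_recl big_ord0 !mxE addr0.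
  have -> : lift 0 0 = 1 :> 'I_3 by apply: val_inj.
  have -> : lift 0 (lift 0 0) = 2 :> 'I_3 by apply: val_inj.
  rewrite -!expr2 addrA => /(congr1 (fun t => t ^+ 2)).
  by rewrite sqr_sqrtr ?expr1n // !addr_ge0 // sqr_ge0.
have cs := cos2Dsin2 (theta / 2).
have key : cos (theta / 2) ^+ 2 + (sin (theta / 2) * v 0 0) ^+ 2
    + (sin (theta / 2) * v 1 0) ^+ 2 + (sin (theta / 2) * v 2 0) ^+ 2 = 1.
  by rewrite !exprMn -!addrA -!mulrDr !addrA v1 mulr1.
rewrite rotE; move: key; move: (cos _) => c.
move: (_ * v 0 0) (_ * v 1 0) (_ * v 2 0) => x y z key.
split.
  apply/unitarymxP; rewrite trmxC_mx2 mul_mx2; apply/matrixP => i j.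
  rewrite !mxE.
  by case: i j => [[|[|//]] ?] [[|[|//]] ?] /=; simpc; congr (Complex _ _);
    rewrite -?key; ring.
rewrite (expand_det_row _ 0) !big_ord_recl big_ord0 /cofactor !det_mx11 !mxE /=.
rewrite expr0 expr1; simpc; congr (Complex _ _); last by ring.
by rewrite -key; ring.
Qed.

(* Main.v *)
Require Import Defs.
From HB Require Import structures.
From mathcomp Require Import all_boot all_order all_algebra.
From mathcomp Require Import complex.
From mathcomp Require Import all_classical all_reals all_analysis.
From mathcomp Require Import spectral ring lra.

Set Implicit Arguments.
Unset Strict Implicit.
Unset Printing Implicit Defensive.

Import Order.TTheory GRing.Theory Num.Theory.
Local Open Scope classical_set_scope.
Local Open Scope ring_scope.

(* For unit vectors v, e write d(v, e; U) for the angle between v and F(U) e.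
   In a product of j + 1 rotations whose axes alternate between m and n, with
   first axis v and last axis e, each further factor moves the reference axis by
   delta, so d(v, e; U) <= j delta by the triangle inequality on the sphere (with
   equality when j = 1).  Conversely, a rotation about v can bring F(U) e to any
   distance from the other axis w between |d - delta| and d + delta; choosing it
   as close to w as useful and inducting on j shows that the inequality is also
   sufficient.  Hence having an alternating word of a given type depends only on
   F(U), which identifies N on SU(2) and SO(3), and the three terms of the
   minimum come from the words of type m..m, n..m and m..n, for which the
   relevant angle is beta, f(alpha, beta, delta) and f(gamma, -beta, delta).  The
   assumption on b says d(m, m; U) <= d(n, n; U), so words of type n..n never do
   better than those of type m..m. *)

(** * Dot and cross products in $\mathbb R^3$ *)

Lemma lift01 : lift 0 0 = 1 :> 'I_3.
Proof. exact: val_inj. Qed.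

Lemma lift02 : lift 0 (lift 0 0) = 2 :> 'I_3.
Proof. exact: val_inj. Qed.

Lemma dotE (R : realType) (u v : 'cV[R]_3) :
  dot u v = u 0 0 * v 0 0 + u 1 0 * v 1 0 + u 2 0 * v 2 0.
Proof.
by rewrite /dot mxE !big_ord_recl big_ord0 !mxE addr0 lift02 lift01 addrA.
Qed.

Lemma vec3P (R : realType) (u v : 'cV[R]_3) :
  u 0 0 = v 0 0 -> u 1 0 = v 1 0 -> u 2 0 = v 2 0 -> u = v.
Proof.
move=> h0 h1 h2; apply/matrixP => i j; rewrite ord1.
have [->|[->|->]] // : i = 0 \/ i = 1 \/ i = 2.
by case: i => [[|[|[|//]]] ?]; [left|right; left|right; right]; exact: val_inj.
Qed.

Lemma vec3_coord (R : realType) (x y z : R) :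
  (vec3 x y z 0 0 = x) * (vec3 x y z 1 0 = y) * (vec3 x y z 2 0 = z).
Proof. by rewrite !mxE. Qed.

Lemma dotC (R : realType) (u v : 'cV[R]_3) : dot u v = dot v u.
Proof. by rewrite !dotE; ring. Qed.

Lemma dotDr (R : realType) (u v w : 'cV[R]_3) :
  dot u (v + w) = dot u v + dot u w.
Proof. by rewrite !dotE !mxE; ring. Qed.

Lemma dotZr (R : realType) (u v : 'cV[R]_3) (a : R) :
  dot u (a *: v) = a * dot u v.
Proof. by rewrite !dotE !mxE; ring. Qed.

Lemma dotZl (R : realType) (u v : 'cV[R]_3) (a : R) :
  dot (a *: u) v = a * dot u v.
Proof. by rewrite !dotE !mxE; ring. Qed.

Lemma dot_ge0 (R : realType) (u : 'cV[R]_3) : 0 <= dot u u.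
Proof. by rewrite dotE -!expr2 !addr_ge0 ?sqr_ge0. Qed.

Lemma dot_eq0 (R : realType) (u : 'cV[R]_3) : dot u u = 0 -> u = 0.
Proof.
rewrite dotE -!expr2 => /eqP; rewrite !paddr_eq0 ?addr_ge0 ?sqr_ge0 //.
rewrite !sqrf_eq0 => /andP[/andP[/eqP h0 /eqP h1] /eqP h2].
by apply: vec3P; rewrite mxE.
Qed.

Lemma S2P (R : realType) (v : 'cV[R]_3) : S2 v <-> dot v v = 1.
Proof.
rewrite /S2 /= /norm2; split=> [h|->]; last by rewrite sqrtr1.
by rewrite -[LHS](sqr_sqrtr (dot_ge0 v)) h expr1n.
Qed.

Lemma cross_dotl (R : realType) (u v : 'cV[R]_3) : dot u (cross u v) = 0.
Proof. by rewrite dotE /cross !vec3_coord; ring. Qed.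

Lemma cross_dotr (R : realType) (u v : 'cV[R]_3) : dot v (cross u v) = 0.
Proof. by rewrite dotE /cross !vec3_coord; ring. Qed.

Lemma triple_cycle (R : realType) (u v w : 'cV[R]_3) :
  dot u (cross v w) = dot v (cross w u).
Proof. by rewrite !dotE /cross !vec3_coord; ring. Qed.

Lemma crossDr (R : realType) (u v w : 'cV[R]_3) :
  cross u (v + w) = cross u v + cross u w.
Proof. by apply: vec3P; rewrite /cross !mxE /= ; ring. Qed.

Lemma crossZr (R : realType) (u v : 'cV[R]_3) (a : R) :
  cross u (a *: v) = a *: cross u v.
Proof. by apply: vec3P; rewrite /cross !mxE /= ; ring. Qed.

Lemma dot_cross_cross (R : realType) (u v w x : 'cV[R]_3) :
  dot (cross u v) (cross w x) = dot u w * dot v x - dot u x * dot v w.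
Proof. by rewrite !dotE /cross !vec3_coord; ring. Qed.

(** This is $\cos^2+\sin^2=1$ for the angle between the projections of [v] and [w] to the plane
    orthogonal to [u], scaled by the lengths of these projections. *)
Lemma gram_triple (R : realType) (u v w : 'cV[R]_3) :
  dot u u = 1 ->
  (dot v w - dot u v * dot u w) ^+ 2 + dot u (cross v w) ^+ 2
  = (dot v v - dot u v ^+ 2) * (dot w w - dot u w ^+ 2).
Proof.
move=> u1.
(* Made homogeneous in [u], the claim becomes a polynomial identity. *)
have : dot u u * ((dot v w * dot u u - dot u v * dot u w) ^+ 2
    + dot u u * dot u (cross v w) ^+ 2)
  = dot u u * ((dot v v * dot u u - dot u v ^+ 2) * (dot w w * dot u u - dot u w ^+ 2)).
  rewrite !dotE /cross !vec3_coord; ring.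
by rewrite u1 !mulr1 !mul1r.
Qed.

Lemma dot_unit_sqr_le1 (R : realType) (u v : 'cV[R]_3) :
  dot u u = 1 -> dot v v = 1 -> dot u v ^+ 2 <= 1.
Proof.
move=> u1 v1; have := dot_cross_cross u v u v; rewrite u1 v1 (dotC v u) => h.
by have := dot_ge0 (cross u v); rewrite h; nra.
Qed.

Lemma sqr_le_itv (R : realType) (x y : R) :
  0 <= y -> x ^+ 2 <= y ^+ 2 -> - y <= x <= y.
Proof. by move=> y0 h; apply/andP; split; nra. Qed.

Lemma dot_unit_itv (R : realType) (u v : 'cV[R]_3) :
  dot u u = 1 -> dot v v = 1 -> -1 <= dot u v <= 1.
Proof.
move=> u1 v1; apply: sqr_le_itv => //.
by rewrite expr1n; exact: dot_unit_sqr_le1.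
Qed.

(** * The arccosine and distances on the sphere *)

Lemma acosK_itv (R : realType) (x : R) : -1 <= x <= 1 -> cos (acos x) = x.
Proof. by move=> h; apply: acosK; rewrite in_itv. Qed.

Lemma le_cos_itv (R : realType) (x y : R) : 0 <= x <= pi -> 0 <= y <= pi ->
  (cos x <= cos y) = (y <= x).
Proof. by move=> hx hy; rewrite !leNgt ltr_cos ?in_itv. Qed.

Lemma acos_itv (R : realType) (x : R) : -1 <= x <= 1 -> 0 <= acos x <= pi.
Proof. by move=> h; rewrite acos_ge0 ?acos_lepi. Qed.

Lemma acos_le (R : realType) (x y : R) : -1 <= x <= 1 -> -1 <= y <= 1 ->
  (acos x <= acos y) = (y <= x).
Proof. by move=> hx hy; rewrite -le_cos_itv ?acos_itv // !acosK_itv. Qed.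

Lemma sin_acos_sqr (R : realType) (x : R) : -1 <= x <= 1 ->
  sin (acos x) ^+ 2 = 1 - x ^+ 2.
Proof. by move=> h; rewrite -{2}(acosK_itv h) -(cos2Dsin2 (acos x)); ring. Qed.

(** [gram_triple] at the middle point [y] bounds $|x\cdot z-\cos a\cos c|$ by $\sin a\sin c$, so
    $x\cdot z\ge\cos(a+c)$; for $a+c\ge\pi$ the bound is trivial. *)
Lemma sphere_triangle (R : realType) (x y z : 'cV[R]_3) :
  dot x x = 1 -> dot y y = 1 -> dot z z = 1 ->
  acos (dot x z) <= acos (dot x y) + acos (dot y z).
Proof.
move=> x1 y1 z1.
have hxy := dot_unit_itv x1 y1; have hyz := dot_unit_itv y1 z1.
have hxz := dot_unit_itv x1 z1.
set a := acos (dot x y); set c := acos (dot y z).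
have a0 : 0 <= a by exact: acos_ge0.
have c0 : 0 <= c by exact: acos_ge0.
have [h|h] := leP pi (a + c); first exact: le_trans (acos_lepi hxz) h.
have ap : 0 <= a <= pi by rewrite a0 acos_lepi.
have cp : 0 <= c <= pi by rewrite c0 acos_lepi.
rewrite -le_cos_itv ?acos_itv //; last by rewrite addr_ge0 ?(ltW h).
rewrite acosK_itv // cosD !acosK_itv //.
have := gram_triple x z y1; rewrite x1 z1 (dotC y x).
rewrite -(sin_acos_sqr hxy) -(sin_acos_sqr hyz) -/a -/c => E.
have : (dot x z - dot x y * dot y z) ^+ 2 <= (sin a * sin c) ^+ 2.
  by rewrite exprMn -E lerDl sqr_ge0.
move=> /(sqr_le_itv (mulr_ge0 (sin_ge0_pi ap) (sin_ge0_pi cp)))/andP[h1 _].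
by move: h1; lra.
Qed.

(** * SU(2) in real coordinates and the homomorphism [F] *)

Local Notation rot := Defs.rot.

(** Four real coordinates of norm 1 reduce facts about [F] to polynomial identities. *)
Lemma SU2_conj_vec (R : realType) (U : 'M[R[i]]_2) : SU2 U ->
  exists p q r s : R,
  [/\ U = mx2 (Complex p q) (Complex (- r) s) (Complex r s) (Complex p (- q)),
      p ^+ 2 + q ^+ 2 + r ^+ 2 + s ^+ 2 = 1
    & forall v, F U *m v = conj_vec p q r s v].
Proof.
move=> hU; have [[p q] [[r s] E]] := SU2_mx2 hU.
have {}E : U = mx2 (Complex p q) (Complex (- r) s) (Complex r s)
    (Complex p (- q)).
  by rewrite E; congr mx2; apply/eqP; rewrite eq_complex /= opprK !eqxx.
exists p, q, r, s; split=> //.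
  have := hU.2; rewrite E (expand_det_row _ 0) !big_ord_recl big_ord0.
  rewrite /cofactor !det_mx11 !mxE /= expr0 expr1; simpc => -[h _].
  by rewrite -h; ring.
by move=> v; apply: (can_inj (@pauliK R)); rewrite -F_pauli // E conj_vecP.
Qed.

Lemma SU2_mul (R : realType) (U V : 'M[R[i]]_2) :
  SU2 U -> SU2 V -> SU2 (U *m V).
Proof.
move=> [hU dU] [hV dV]; split; first exact: mul_unitarymx.
by rewrite det_mulmx dU dV mulr1.
Qed.

Lemma SU2_1 (R : realType) : SU2 (1%:M : 'M[R[i]]_2).
Proof.
by split; rewrite ?det1 //; apply/unitarymxP; rewrite trmx1 map_mx1 mulmx1.
Qed.

Lemma mulmx_cV_inj (R : realType) (A B : 'M[R]_3) :
  (forall v : 'cV[R]_3, A *m v = B *m v) -> A = B.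
Proof.
move=> h; apply/matrixP => i j.
by have := congr1 (fun C : 'cV[R]_3 => C i 0) (h (delta_mx j 0));
  rewrite -!colE !mxE.
Qed.

Lemma F_mul (R : realType) (U V : 'M[R[i]]_2) :
  SU2 U -> SU2 V -> F (U *m V) = F U *m F V.
Proof.
move=> hU hV; apply: mulmx_cV_inj => v; apply: (can_inj (@pauliK R)).
rewrite -F_pauli; last exact: SU2_mul.
by rewrite -[F U *m _ *m v]mulmxA -!F_pauli // trmx_mul map_mxM /= !mulmxA.
Qed.

Lemma F1 (R : realType) : F (1%:M : 'M[R[i]]_2) = 1%:M.
Proof.
apply: mulmx_cV_inj => v; apply: (can_inj (@pauliK R)).
rewrite -F_pauli; last exact: SU2_1.
by rewrite trmx1 map_mx1 mulmx1 !mul1mx.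
Qed.

Lemma dot_F (R : realType) (U : 'M[R[i]]_2) (x y : 'cV[R]_3) :
  SU2 U -> dot (F U *m x) (F U *m y) = dot x y.
Proof.
move=> /SU2_conj_vec[p [q [r [s [_ h1 hF]]]]].
(* [conj_vec] multiplies dot products by $(p^2+q^2+r^2+s^2)^2$, which is 1 here. *)
rewrite !hF -[RHS]mul1r -(expr1n _ 2) -h1 /conj_vec !dotE !vec3_coord; ring.
Qed.

(** * Rotations about an axis *)

(** Rodrigues' rotation formula, obtained by comparing coordinates in half angles. *)
Lemma F_rot (R : realType) (v x : 'cV[R]_3) (t : R) : S2 v ->
  F (rot v t) *m x
  = cos t *: x + sin t *: cross v x + ((1 - cos t) * dot v x) *: v.
Proof.
move=> hv; have /S2P v1 := hv.
apply: (can_inj (@pauliK R)); rewrite -F_pauli; last exact: rot_SU2.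
rewrite rotE -[X in mx2 _ _ _ (Complex _ X)]opprK conj_vecP; congr pauli.
have ct : cos t = cos (t / 2) ^+ 2 *+ 2 - 1.
  by rewrite -cos_mulr2n; congr cos; lra.
have st : sin t = (cos (t / 2) * sin (t / 2)) *+ 2.
  by rewrite -sin_mulr2n; congr sin; lra.
rewrite ct st.
have hc := cos2Dsin2 (t / 2); move: v1; rewrite dotE.
move: (cos _) (sin _) hc => c s hc v1.
have -> : 1 - (c ^+ 2 *+ 2 - 1) = 2 * s ^+ 2 by move: hc; lra.
(* Writing 1 as [dot v v] makes both sides agree as polynomials. *)
have -> : c ^+ 2 *+ 2 - 1 = c ^+ 2 - s ^+ 2 * dot v v.
  by rewrite dotE v1; move: hc; lra.
by apply: vec3P; rewrite /conj_vec /cross vec3_coord !mxE /= !dotE; ring.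
Qed.

Lemma rot_axisM (R : realType) (v : 'cV[R]_3) (s t : R) : S2 v ->
  rot v s *m rot v t = rot v (s + t).
Proof.
move=> /S2P; rewrite dotE => v1; rewrite !rotE mul_mx2 mulrDl cosD sinD.
have E (a b : R) : a * b = a * b * (v 0 0 * v 0 0 + v 1 0 * v 1 0 + v 2 0 * v 2 0).
  by rewrite v1 mulr1.
(* The product of sines receives the factor $\|v\|^2=1$ that the matrix product carries. *)
rewrite [X in _ - X]E.
by congr mx2; simpc; congr (Complex _ _); ring.
Qed.

Lemma rot_axis0 (R : realType) (v : 'cV[R]_3) : rot v 0 = 1%:M.
Proof.
rewrite /rot mul0r cos0 sin0 -[X in _ * X]/(0 : R[i]) mulr0 scale0r subr0.
by rewrite -[X in X *: _]/(1 : R[i]) scale1r.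
Qed.

Lemma F_rot_axis (R : realType) (v : 'cV[R]_3) (t : R) :
  S2 v -> F (rot v t) *m v = v.
Proof.
move=> hv; have /S2P v1 := hv.
rewrite F_rot // v1 mulr1.
have -> : cross v v = 0 by apply: vec3P; rewrite /cross !mxE /=; ring.
by rewrite scaler0 addr0 -scalerDl addrC subrK scale1r.
Qed.

Lemma dot_F_rot_axis (R : realType) (v x : 'cV[R]_3) (t : R) :
  S2 v -> dot v (F (rot v t) *m x) = dot v x.
Proof. by move=> hv; rewrite -{1}(F_rot_axis t hv) dot_F //; exact: rot_SU2. Qed.

Lemma circle_point (R : realType) (x y : R) : x ^+ 2 + y ^+ 2 = 1 ->
  exists a, cos a = x /\ sin a = y.
Proof.
move=> h; have hx : -1 <= x <= 1 by apply: sqr_le_itv => //; nra.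
have hs := sin_acos_sqr hx.
have [y0|y0] := leP 0 y.
  exists (acos x); split; first exact: acosK_itv.
  apply: (@pexpIrn _ 2) => //; rewrite ?nnegrE ?sin_ge0_pi ?acos_itv //; lra.
exists (- acos x); rewrite cosN sinN; split; first exact: acosK_itv.
apply/eqP; rewrite eqr_oppLR; apply/eqP; apply: (@pexpIrn _ 2) => //.
- by rewrite nnegrE sin_ge0_pi ?acos_itv.
- by rewrite nnegrE oppr_ge0 ltW.
- by rewrite hs sqrrN; lra.
Qed.

(* [U = p I + i (s X - r Y + q Z)], and fixing [v] forces [(s, -r, q)] to be
   parallel to [v]. *)
Lemma SU2_fix_axis (R : realType) (U : 'M[R[i]]_2) (v : 'cV[R]_3) :
  S2 v -> SU2 U -> dot v (F U *m v) = 1 -> rots v U.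
Proof.
move=> /S2P v1 /SU2_conj_vec[p [q [r [s [-> h1 hF]]]]]; rewrite hF => h.
set u : 'cV[R]_3 := vec3 s (- r) q.
have u2 : dot u u = 1 - p ^+ 2.
  by rewrite dotE /u !vec3_coord -h1; ring.
have E : p ^+ 2 + (- dot u v) ^+ 2 = 1.
  have : dot v (conj_vec p q r s v)
      = (p ^+ 2 - dot u u) * dot v v + 2 * dot u v ^+ 2.
    by rewrite !dotE /conj_vec /u !vec3_coord; ring.
  by rewrite h u2 v1 sqrrN; lra.
(* Equality in Cauchy-Schwarz: $\|u-(u\cdot v)v\|^2=\|u\|^2-(u\cdot v)^2=0$. *)
have uv : u = dot u v *: v.
  apply/eqP; rewrite -subr_eq0; apply/eqP/dot_eq0.
  have dotZ k : dot (u - k *: v) (u - k *: v)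
      = dot u u - 2 * k * dot u v + k ^+ 2 * dot v v.
    by rewrite !dotE !mxE; ring.
  by rewrite dotZ u2 v1; move: E; rewrite sqrrN; lra.
have [a [ca sa]] := circle_point E.
exists (a * 2) => //; rewrite rotE mulfK ?pnatr_eq0 // ca sa.
have uvi i : dot u v * v i 0 = u i 0 by rewrite [in RHS]uv mxE.
by rewrite !mulNr !uvi /u !vec3_coord !opprK.
Qed.

Local Opaque Defs.rot F.

(** * Positions reachable by one rotation *)

Lemma circle_linear (R : realType) (x y s : R) : s ^+ 2 <= x ^+ 2 + y ^+ 2 ->
  exists t, cos t * x + sin t * y = s.
Proof.
move=> hs; set d := x ^+ 2 + y ^+ 2 in hs.
have [d0|d0] := eqVneq d 0.
  have s0 : s = 0 by apply/eqP; rewrite -sqrf_eq0 eq_le sqr_ge0 -d0 hs.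
  move/eqP: d0; rewrite paddr_eq0 ?sqr_ge0 // !sqrf_eq0 => /andP[/eqP-> /eqP->].
  by exists 0; rewrite s0 !mulr0 addr0.
have h0 : 0 <= d - s ^+ 2 by rewrite subr_ge0.
set h := Num.sqrt (d - s ^+ 2).
have h2 : h ^+ 2 = d - s ^+ 2 by rewrite sqr_sqrtr.
(* The point where the line $\{z:z\cdot(x,y)=s\}$ meets the unit circle: its foot $s(x,y)/d$ plus
   the perpendicular shift $h(-y,x)/d$. *)
have [] := @circle_point R ((s * x - h * y) / d) ((s * y + h * x) / d).
  have -> : ((s * x - h * y) / d) ^+ 2 + ((s * y + h * x) / d) ^+ 2
      = (s ^+ 2 + h ^+ 2) * (x ^+ 2 + y ^+ 2) / d ^+ 2 by field.
  by rewrite h2 addrC subrK -/d -expr2 divff // expf_neq0.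
move=> t [ct st]; exists t; rewrite ct st.
have -> : (s * x - h * y) / d * x + (s * y + h * x) / d * y
  = s * (x ^+ 2 + y ^+ 2) / d by field.
by rewrite -/d mulfK.
Qed.

(* Turning [x] about [v] moves it along a circle; the condition says that [t]
   lies between the cosines of the extreme distances from [w] to that circle. *)
Lemma rot_reach (R : realType) (v w x : 'cV[R]_3) (t : R) :
  S2 v -> dot w w = 1 -> dot x x = 1 ->
  (t - dot v w * dot v x) ^+ 2 <= (1 - dot v w ^+ 2) * (1 - dot v x ^+ 2) ->
  exists s, dot w (F (rot v s) *m x) = t.
Proof.
move=> hv w1 x1; have /S2P v1 := hv.
(* By [F_rot], the dot product to be reached is a sinusoid in the angle with mean
   [dot v w * dot v x]; [gram_triple] identifies the bound with its squared amplitude. *)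
have := gram_triple x w v1; rewrite w1 x1 [X in _ = X -> _]mulrC => <-.
move=> /circle_linear[s hs]; exists s.
rewrite F_rot // !dotDr !dotZr (dotC w v) triple_cycle (dotC w x).
by move: hs; lra.
Qed.

(** * Alternating words and the distance criterion *)

(** The index [e] belongs to the rightmost axis and words grow to the left, so parity determines the
    leftmost axis. Angles may be 0. *)
Fixpoint alt_word (R : realType) (a : bool -> 'cV[R]_3) (e : bool) (j : nat) :
    set 'M[R[i]]_2 :=
  if j is j'.+1 then
    [set U | exists t W, alt_word a e j' W
                         /\ U = rot (a (e (+) odd j')) t *m W]
  else [set 1%:M].

Lemma alt_word1 (R : realType) (a : bool -> 'cV[R]_3) (e : bool)
    (U : 'M[R[i]]_2) :
  alt_word a e 1 U <-> rots (a e) U.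
Proof.
split=> [[t [W [W1 ->]]]|[t _ <-]].
  by rewrite W1 addbF; exists t => //; exact: esym (mulmx1 _).
by exists t, 1%:M; split=> //; rewrite addbF; exact: esym (mulmx1 _).
Qed.

Lemma alt_word_SU2 (R : realType) (a : bool -> 'cV[R]_3) (e : bool) (j : nat)
    (U : 'M[R[i]]_2) :
  (forall e, S2 (a e)) -> alt_word a e j U -> SU2 U.
Proof.
move=> ha; elim: j U => [|j IH] U /=; first by move=> ->; exact: SU2_1.
by move=> [t [W [/IH hW ->]]]; apply: SU2_mul => //; exact: rot_SU2.
Qed.

Lemma dot_axes (R : realType) (a : bool -> 'cV[R]_3) (e : bool) :
  dot (a e) (a (~~ e)) = dot (a false) (a true).
Proof. by case: e => //=; rewrite dotC. Qed.

Lemma axis_dist_le (R : realType) (a : bool -> 'cV[R]_3) (e : bool) (j : nat)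
    (U : 'M[R[i]]_2) :
  (forall e, S2 (a e)) -> alt_word a e j.+1 U ->
  acos (dot (a (e (+) odd j)) (F U *m a e))
    <= j%:R * acos (dot (a false) (a true)).
Proof.
move=> ha; have a1 c : dot (a c) (a c) = 1 by apply/S2P.
elim: j U => [|j IH] U.
  move=> /alt_word1[t _ <-].
  by rewrite addbF F_rot_axis // a1 acos1 mul0r.
move=> [t [W [hW ->]]].
have sW : SU2 W by apply: (@alt_word_SU2 R a e j.+1).
rewrite F_mul //; last exact: rot_SU2.
rewrite -mulmxA dot_F_rot_axis //.
(* The intermediate point is the leftmost axis of [W], at distance $\delta$ from the new one. *)
apply: le_trans (sphere_triangle (y := a (e (+) odd j)) _ _ _) _ => //.
  by rewrite dot_F.
rewrite /= addbN dotC dot_axes -natr1 mulrDl mul1r addrC lerD2r.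
exact: IH.
Qed.

(** Each of the two factors fixes one of the two axes, so the distance is exactly $\delta$. This
    stricter condition is the source of the exceptional value 4 of [g]. *)
Lemma axis_dist_alt2 (R : realType) (a : bool -> 'cV[R]_3) (e : bool)
    (U : 'M[R[i]]_2) :
  (forall e, S2 (a e)) -> alt_word a e 2 U ->
  dot (a (~~ e)) (F U *m a e) = dot (a false) (a true).
Proof.
move=> ha [t [W [/alt_word1[s _ <-] ->]]].
rewrite (F_mul (rot_SU2 t (ha _)) (rot_SU2 s (ha _))) -mulmxA addbT.
by rewrite dot_F_rot_axis // F_rot_axis // dotC dot_axes.
Qed.

(** Induction on [j]: a rotation about the leftmost axis is split off so that the remaining matrix
    meets the criterion one step lower. The last hypothesis reflects that two factors force distance
    exactly $\delta$. *)
Lemma alt_word_of_dist (R : realType) (a : bool -> 'cV[R]_3) (e : bool)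
    (j : nat) (U : 'M[R[i]]_2) :
  (forall e, S2 (a e)) -> 0 <= dot (a false) (a true) < 1 -> SU2 U ->
  acos (dot (a (e (+) odd j)) (F U *m a e))
    <= j%:R * acos (dot (a false) (a true)) ->
  (j = 1%N -> dot (a (~~ e)) (F U *m a e) = dot (a false) (a true)) ->
  alt_word a e j.+1 U.
Proof.
move=> ha hk; have a1 c : dot (a c) (a c) = 1 by apply/S2P.
move kE : (dot (a false) (a true)) hk => k hk.
have ki : -1 <= k <= 1 by lra.
have kd : 0 < acos k by apply: acos_gt0; lra.
have kd2 : acos k <= pi / 2 by rewrite -acos0 acos_le //; lra.
elim: j U => [|j IH] U sU.
  rewrite addbF mul0r => h _.
  have hi : -1 <= dot (a e) (F U *m a e) <= 1.
    by apply: dot_unit_itv; rewrite ?dot_F.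
  apply/alt_word1.
  apply: SU2_fix_axis => //; rewrite -(acosK_itv hi).
  by rewrite (_ : acos _ = 0) ?cos0 //; apply/eqP; rewrite eq_le h acos_ge0.
move vE : (a (e (+) odd j.+1)) => v; move wE : (a (e (+) odd j)) IH => w IH.
move xE : (F U *m a e) => x hr hj.
have hv : S2 v by rewrite -vE.
have w1 : dot w w = 1 by rewrite -wE.
have x1 : dot x x = 1 by rewrite -xE dot_F.
have vw : dot v w = k by rewrite -vE -wE /= addbN dotC dot_axes.
have hc : -1 <= dot v x <= 1 by apply: dot_unit_itv => //; exact/S2P.
(* Here [t] is the cosine of the new distance to [w]. The three conditions are reachability, the
   bound for induction, and the exact distance required if two factors remain. *)
suff [t [ht1 ht2 ht3]] : exists t,
    [/\ (t - k * dot v x) ^+ 2 <= (1 - k ^+ 2) * (1 - dot v x ^+ 2),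
        acos t <= j%:R * acos k & j = 1%N -> t = k].
  rewrite -vw in ht1.
  have [s hs] := rot_reach hv w1 x1 ht1.
  have sV := rot_SU2 s hv.
  exists (- s), (rot v s *m U); split.
    have Fx : F (rot v s *m U) *m a e = F (rot v s) *m x.
      by rewrite (F_mul sV sU) -mulmxA xE.
    apply: IH; first exact: SU2_mul.
      by rewrite Fx hs.
    move=> j1; rewrite Fx -(ht3 j1) -[RHS]hs.
    by congr dot; rewrite -wE j1 addbT.
  by rewrite vE mulmxA (rot_axisM _ _ hv) addNr rot_axis0 mul1mx.
have {}hj : j = 0%N -> dot v x = k.
  by move=> j0; rewrite -hj ?j0 // -vE j0 /= addbT.
move: (dot v x) hr hj hc => c hr hj hc; move: {IH vE wE} hr hj.
case: j => [|[|j]] hr hj.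
(* One factor remains: [x] is at distance $\delta$ from [v], as [w] is, and can be turned onto
   [w]. *)
- exists 1; rewrite acos1 mul0r (hj erefl); split=> //.
(* Two factors remain, so the new distance must be $\delta$ itself; this is reachable because the
   old distance is at most $2\delta\le\pi$, that is $c\ge\cos 2\delta=2k^2-1$. *)
- exists k; rewrite mul1r; split=> //.
  have : 2 * k ^+ 2 - 1 <= c.
    have -> : 2 * k ^+ 2 - 1 = cos (acos k *+ 2).
      by rewrite cos_mulr2n acosK_itv // mulr_natl.
    rewrite -(acosK_itv hc) le_cos_itv ?acos_itv //.
      by rewrite -mulr_natl.
    by lra.
  have [c1 c2] := andP hc.
  move=> h; rewrite -subr_ge0.
  have -> : (1 - k ^+ 2) * (1 - c ^+ 2) - (k - k * c) ^+ 2
      = (1 - c) * (c - (2 * k ^+ 2 - 1)) by ring.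
  by apply: mulr_ge0; rewrite subr_ge0.
(* With more factors left, [x] is brought as close to [w] as possible, to distance $|\arccos
   c-\delta|$. *)
- exists (cos (acos c - acos k)); split=> //.
    rewrite cosB !acosK_itv // (mulrC c) addrAC subrr add0r exprMn.
    by rewrite !sin_acos_sqr // mulrC.
  have [c0 cp] := andP (acos_itv hc).
  have jk : acos k <= j.+2%:R * acos k.
    by rewrite ler_peMl ?ler1n // ltW.
  rewrite -cos_norm cosK ?in_itv /= ?normr_ge0 ?ler_norml /=; last by lra.
  by move: hr; rewrite -(natr1 j.+2) mulrDl mul1r; lra.
Qed.

(** * From arbitrary products to alternating words *)

(** The new factor either continues the alternation or has the leftmost axis and merges with the
    leftmost factor. *)
Lemma alt_word_cons (R : realType) (a : bool -> 'cV[R]_3) (e c : bool)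
    (j : nat) (t : R) (W : 'M[R[i]]_2) :
  (forall e, S2 (a e)) -> alt_word a e j.+1 W ->
  exists2 i, (i <= j.+1)%N & alt_word a e i.+1 (rot (a c) t *m W).
Proof.
move=> ha hW; have [cE|cE] := eqVneq c (e (+) odd j.+1).
  by exists j.+1; [exact: leqnn | exists t, W; split; [|rewrite cE]].
have {}cE : c = e (+) odd j by move: cE; rewrite /= addbN; case: (c) (e (+) odd j) => [] [].
exists j; first exact: leqnSn.
case: hW => s [V [hV ->]]; exists (t + s), V; split; first exact: hV.
by rewrite cE mulmxA (rot_axisM _ _ (ha _)).
Qed.

Lemma prod_rot_alt_word (R : realType) (a : bool -> 'cV[R]_3) (j : nat)
    (c : 'I_j.+1 -> bool * R) :
  (forall e, S2 (a e)) ->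
  exists e i, (i <= j)%N
    /\ alt_word a e i.+1 (\prod_(k < j.+1) rot (a (c k).1) (c k).2).
Proof.
move=> ha; elim: j c => [|j IH] c.
  rewrite big_ord1; exists (c ord0).1, 0%N; split; first exact: leqnn.
  by apply/alt_word1; exists (c ord0).2.
rewrite big_ord_recl.
have [e [i [ij hW]]] := IH (fun k => c (lift ord0 k)).
have [i' i'i h] := alt_word_cons (c ord0).1 (c ord0).2 ha hW.
by exists e, i'; split; [exact: leq_trans i'i _ | exact: h].
Qed.

Lemma prod_cons (A : pzRingType) (T : Type) (h : T -> A) (x : T) (j : nat)
    (c : 'I_j -> T) :
  exists c' : 'I_j.+1 -> T, h x * \prod_(k < j) h (c k) = \prod_(k < j.+1) h (c' k).
Proof.
exists (fun k => oapp c x (unlift ord0 k)).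
rewrite big_ord_recl unlift_none /=; congr (_ * _).
by apply: eq_bigr => k _; rewrite liftK.
Qed.

Lemma alt_word_prod_rot (R : realType) (a : bool -> 'cV[R]_3) (e : bool)
    (j : nat) (U : 'M[R[i]]_2) : alt_word a e j U ->
  exists c : 'I_j -> bool * R, U = \prod_(k < j) rot (a (c k).1) (c k).2.
Proof.
elim: j U => [|j IH] U.
  by move=> ->; exists (fun=> (true, 0)); rewrite big_ord0.
move=> [s [W [/IH[c ->] ->]]].
have [c' hc'] := prod_cons (fun ct => rot (a ct.1) ct.2) (e (+) odd j, s) c.
by exists c'; exact: hc'.
Qed.

Lemma prod_rot_SU2 (R : realType) (a : bool -> 'cV[R]_3) (j : nat)
    (c : 'I_j -> bool * R) :
  (forall e, S2 (a e)) -> SU2 (\prod_(k < j) rot (a (c k).1) (c k).2).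
Proof.
move=> ha; elim: j c => [|j IH] c; first by rewrite big_ord0; exact: SU2_1.
by rewrite big_ord_recl; apply: SU2_mul; [exact: rot_SU2|exact: IH].
Qed.

Lemma F_prod_rot (R : realType) (a : bool -> 'cV[R]_3) (j : nat)
    (c : 'I_j -> bool * R) :
  (forall e, S2 (a e)) ->
  F (\prod_(k < j) rot (a (c k).1) (c k).2) = \prod_(k < j) F (rot (a (c k).1) (c k).2).
Proof.
move=> ha; elim: j c => [|j IH] c; first by rewrite !big_ord0; exact: F1.
rewrite !big_ord_recl -IH; apply: F_mul; first exact: rot_SU2.
exact: prod_rot_SU2.
Qed.

Lemma word_length_eq (A : pzRingType) (S : set A) (x : A) (j : nat) :
  (exists V : 'I_j.+1 -> A, (forall k, S (V k)) /\ x = \prod_(k < j.+1) V k) ->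
  (forall i, (exists V : 'I_i.+1 -> A,
      (forall k, S (V k)) /\ x = \prod_(k < i.+1) V k) -> (j <= i)%N) ->
  word_length S x = j.+1.
Proof.
move=> hj hmin; apply: xget_unique => [|i [[i0 hi] hi']].
  by split=> [|[|i] [i0 hi]]; [split|by []|exact: hmin].
apply/eqP; rewrite eqn_leq (hi' j.+1 (conj isT hj)) /=.
by case: i i0 hi {hi'} => // i _ /hmin.
Qed.

(* Membership in [alt_word] depends on [F U] only, so that words for [F U] in
   SO(3) can be replaced by words for [U] itself. *)
Lemma alt_word_F (R : realType) (a : bool -> 'cV[R]_3) (e : bool) (j : nat)
    (U W : 'M[R[i]]_2) :
  (forall e, S2 (a e)) -> 0 <= dot (a false) (a true) < 1 -> SU2 U ->
  F U = F W -> alt_word a e j.+1 W -> alt_word a e j.+1 U.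
Proof.
move=> ha hk hU UW hW; apply: alt_word_of_dist => //.
  by rewrite UW; exact: axis_dist_le.
by move=> j1; rewrite j1 in hW; rewrite UW; exact: axis_dist_alt2.
Qed.

(** A word for [F U] lifts to a word for some [W] in SU(2) with [F W = F U]; although [W] may be
    [- U], [alt_word_F] gives a word of the same type and length for [U]. *)
Lemma N_eq_alt_word (R : realType) (m n : 'cV[R]_3) (U : 'M[R[i]]_2)
    (a := fun e : bool => if e then n else m) (e : bool) (j : nat) :
  S2 m -> S2 n -> 0 <= dot m n < 1 -> SU2 U ->
  alt_word a e j.+1 U ->
  (forall c i, alt_word a c i.+1 U -> (j <= i)%N) ->
  N_SU2 m n U = j.+1 /\ N_SO3 m n (F U) = j.+1.
Proof.
move=> hm hn hk hU hj hmin; have ha c : S2 (a c) by case: c.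
have [c Uc] := alt_word_prod_rot hj.
have rotsP (V : 'M[R[i]]_2) :
    (rots m `|` rots n) V -> exists ct, V = rot (a ct.1) ct.2.
  by move=> [[s _ <-]|[s _ <-]]; [exists (false, s)|exists (true, s)].
have rotsFP (V : 'M[R]_3) :
    (rotsF m `|` rotsF n) V -> exists ct, V = F (rot (a ct.1) ct.2).
  by move=> [[s _ <-]|[s _ <-]]; [exists (false, s)|exists (true, s)].
split; apply: word_length_eq.
- exists (fun k => rot (a (c k).1) (c k).2); split=> // k.
  by rewrite /a; case: (c k) => [[] t]; [right|left]; exists t.
- move=> i [V [hV UV]].
  have [ct hct] := choice (fun k => rotsP _ (hV k)).
  have [e' [i' [i'i h]]] :=
    prod_rot_alt_word ct ha.
  apply: leq_trans i'i; apply: (hmin e').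
  by rewrite UV (eq_bigr _ (fun k _ => hct k)).
- exists (fun k => F (rot (a (c k).1) (c k).2)); split=> [k|].
    by rewrite /a; case: (c k) => [[] t]; [right|left]; exists t.
  by rewrite Uc F_prod_rot.
- move=> i [V [hV UV]].
  have [ct hct] := choice (fun k => rotsFP _ (hV k)).
  have [e' [i' [i'i h]]] :=
    prod_rot_alt_word ct ha.
  apply: leq_trans i'i; apply: (hmin e').
  apply: (alt_word_F ha hk hU _ h).
  by rewrite F_prod_rot // UV; apply: eq_bigr => k _.
Qed.

(** * The quantities [b] and [f], and the ceilings *)

(** Since [w] does not depend on [v], comparing values of [b] amounts to comparing how far [F U]
    moves the axes. *)
Lemma dot_F_b (R : realType) (U : 'M[R[i]]_2) : SU2 U ->
  exists w : R, forall v, S2 v ->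
    dot v (F U *m v) = 2 * w ^+ 2 - 1 + 2 * b v U ^+ 2.
Proof.
move=> /SU2_conj_vec[p [q [r [s [UE h1 hF]]]]]; exists p => v /S2P v1.
have uE : im_vec U = vec3 s (- r) q.
  by rewrite UE /im_vec /pauli_coord; congr vec3; rewrite !mxE /=; simpc => /=; ring.
rewrite /b real_normK ?num_real // uE hF.
have -> : dot v (conj_vec p q r s v)
    = (p ^+ 2 - (q ^+ 2 + r ^+ 2 + s ^+ 2)) * dot v v
      + 2 * dot (vec3 s (- r) q) v ^+ 2.
  by rewrite !dotE /conj_vec !vec3_coord; ring.
by rewrite v1; move: h1; lra.
Qed.

(** The radicand is $(1+c)/2$, a squared half-angle cosine. By the spherical law of cosines, [f] is
    the side opposite the angle [alpha] enclosed by sides [beta] and [delta]. *)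
Lemma f_acos (R : realType) (alpha beta delta : R)
    (c := cos beta * cos delta + cos alpha * sin beta * sin delta) :
  -1 <= c <= 1 -> f alpha beta delta = acos c.
Proof.
move=> hc; rewrite /f; set E := (X in Num.sqrt X).
have cosE (x : R) : cos x = cos (x / 2) ^+ 2 - sin (x / 2) ^+ 2.
  by rewrite {1}(splitr x) cosD -!expr2.
have sinE (x : R) : sin x = 2 * sin (x / 2) * cos (x / 2).
  by rewrite {1}(splitr x) sinD; ring.
have EE : 2 * E = 1 + c.
  rewrite /E /c (cosE beta) (cosE delta) (sinE beta) (sinE delta).
  have := cos2Dsin2 (beta / 2); have := cos2Dsin2 (delta / 2).
  move: (cos (beta / 2)) (sin (beta / 2)) (cos (delta / 2)) (sin (delta / 2)).
  move=> cb sb cd sd hd hb.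
  (* The product of the two Pythagorean identities supplies the quartic relation that makes the goal
     linear in monomials. *)
  have : (cb ^+ 2 + sb ^+ 2) * (cd ^+ 2 + sd ^+ 2) = 1 by rewrite hb hd mulr1.
  by lra.
have E0 : 0 <= E by lra.
have hE : -1 <= Num.sqrt E <= 1.
  apply: sqr_le_itv => //; rewrite sqr_sqrtr // expr1n; lra.
have [a0 ap] := andP (acos_itv hE).
have a2 : acos (Num.sqrt E) <= pi / 2.
  by rewrite -acos0 acos_le ?sqrtr_ge0 //; lra.
rewrite -[LHS]cosK; last by rewrite in_itv /=; lra.
by rewrite mulr_natl cos_mulr2n acosK_itv // sqr_sqrtr // -mulr_natl EE; congr acos; ring.
Qed.

(** Gives the least [j] for which $2j+1$ factors of type m..m suffice. *)
Lemma ceil_even_steps (R : realType) (beta delta : R) :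
  0 < delta -> 0 <= beta ->
  exists2 i : nat, Num.ceil (beta / (2 * delta)) = i%:Z
    & forall j : nat, (beta <= j.*2%:R * delta) = (i <= j)%N.
Proof.
move=> d0 b0; have d2 : 0 < 2 * delta by lra.
have c0 : 0 <= Num.ceil (beta / (2 * delta)).
  by rewrite ceil_ge0; apply: lt_le_trans (divr_ge0 b0 (ltW d2)); lra.
exists `|Num.ceil (beta / (2 * delta))|%N; first by rewrite gez0_abs.
move=> j; rewrite -lez_nat gez0_abs // ceil_le_int ler_pdivrMr //.
by rewrite -mul2n natrM; congr (_ <= _); rewrite mulrAC mulrC.
Qed.

(** The condition on [j] is the criterion for $2j+2$ factors with different end axes, so the least
    such length is the value of [g]. *)
Lemma ceil_odd_steps (R : realType) (r delta : R) : 0 < delta -> 0 <= r ->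
  exists2 i : nat,
    (if delta <= r then 2 * Num.ceil (r / (2 * delta) + 1 / 2) else 4)
      = (i.*2.+2)%:Z
    & forall j : nat, (r <= j.*2.+1%:R * delta /\ (j = 0%N -> r = delta))
        <-> (i <= j)%N.
Proof.
move=> d0 r0; have d2 : 0 < 2 * delta by lra.
have [dr|rd] := leP delta r; last first.
  (* For $r<\delta$ two factors are impossible, while four suffice. *)
  exists 1%N => // -[|j]; split=> //; first by move=> [_ /(_ erefl)]; lra.
  move=> _; split=> //; apply: (le_trans (ltW rd)).
  by rewrite ler_peMl ?ler1n // ltW.
set c := Num.ceil _.
have c0 : 0 < c by rewrite ceil_gt0 addr_gt0 ?divr_gt0 //; lra.
have [i cE] : exists i : nat, c = i.+1%:Z.
  by case: (c) c0 => [[|i]|] // _; exists i.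
exists i; first by rewrite cE -doubleS -mul2n PoszM.
move=> j; have -> : (i <= j)%N = (r <= j.*2.+1%:R * delta).
  have := ceil_le_int (r / (2 * delta) + 1 / 2) j.+1%:Z.
  rewrite -/c cE lez_nat ltnS => ->; rewrite -lerBrDr ler_pdivrMr //.
  by congr (_ <= _); rewrite -pmulrn -!natr1 -mul2n natrM; field.
by split=> [[]|h] //; split=> // j0; apply/eqP; rewrite eq_le dr andbT; move: h;
  rewrite j0 mul1r.
Qed.

(** * Distances for the Euler product *)

Lemma sin_acos_dot (R : realType) (m n : 'cV[R]_3) : S2 m -> S2 n ->
  sin (acos (dot m n)) = norm2 (cross m n).
Proof.
move=> /S2P m1 /S2P n1; rewrite sin_acos; last exact: dot_unit_itv.
by rewrite /norm2 dot_cross_cross m1 n1 (dotC n m) mul1r -expr2.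
Qed.

(** Abstract matrices with Rodrigues' formulas as hypotheses leave only vector algebra. The third
    formula mirrors the second: inverting the product exchanges the outer angles and negates all
    angles, and $\cos(-\gamma)=\cos\gamma$. *)
Lemma euler_dots (R : realType) (m n l : 'cV[R]_3) (alpha beta gamma delta : R)
    (A B C : 'M[R]_3) :
  dot m m = 1 -> dot l l = 1 -> dot m l = 0 -> dot n l = 0 ->
  dot m n = cos delta -> cross m n = sin delta *: l ->
  (forall x : 'cV[R]_3, A *m x
     = cos alpha *: x + sin alpha *: cross m x + ((1 - cos alpha) * dot m x) *: m) ->
  (forall x : 'cV[R]_3, B *m x
     = cos beta *: x + sin beta *: cross l x + ((1 - cos beta) * dot l x) *: l) ->
  (forall x : 'cV[R]_3, C *m x
     = cos gamma *: x + sin gamma *: cross m x + ((1 - cos gamma) * dot m x) *: m) ->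
  (forall x : 'cV[R]_3, dot m (A *m x) = dot m x) ->
  (forall x : 'cV[R]_3, dot m (C *m x) = dot m x) ->
  C *m m = m ->
  [/\ dot m (A *m (B *m (C *m m))) = cos beta,
      dot n (A *m (B *m (C *m m)))
        = cos beta * cos delta + cos alpha * sin beta * sin delta
    & dot m (A *m (B *m (C *m n)))
        = cos (- beta) * cos delta + cos gamma * sin (- beta) * sin delta].
Proof.
move=> m1 l1 ml nl cd lE FA FB FC mA mC Cm.
have lmn : dot l (cross m n) = sin delta by rewrite lE dotZr l1 mulr1.
have Bm : B *m m = cos beta *: m + sin beta *: cross l m.
  by rewrite FB (dotC l m) ml mulr0 scale0r addr0.
have nlm : dot n (cross l m) = sin delta by rewrite triple_cycle lmn.
have mlm : dot m (cross l m) = 0 by exact: cross_dotr.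
split.
- by rewrite mA Cm Bm dotDr !dotZr m1 mlm mulr0 addr0 mulr1.
- rewrite Cm Bm FA !(dotDr, dotZr).
  (* The cross product is a multiple of [l], which is orthogonal to [n]. *)
  have -> : dot n (cross m (cos beta *: m + sin beta *: cross l m)) = 0.
    rewrite crossDr !crossZr dotDr !dotZr.
    have -> : dot n (cross m m) = 0 by rewrite !dotE /cross !vec3_coord; ring.
    have -> : dot n (cross m (cross l m)) = dot m m * dot n l - dot n m * dot m l.
      by rewrite !dotE /cross !vec3_coord; ring.
    by rewrite nl ml; ring.
  rewrite nlm mlm m1 (dotC n m) cd; ring.
- rewrite mA FB !dotDr !dotZr ml mulr0 addr0 mC cosN sinN cd.
  have -> : dot m (cross l (C *m n)) = - (cos gamma * sin delta).
    rewrite FC !crossDr !crossZr !dotDr !dotZr lE crossZr dotZr mlm.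
    have -> : dot m (cross l l) = 0 by rewrite !dotE /cross !vec3_coord; ring.
    have -> : dot m (cross l n) = - dot l (cross m n).
      by rewrite !dotE /cross !vec3_coord; ring.
    by rewrite lmn; ring.
  by ring.
Qed.

Lemma Umat_dots (R : realType) (m n l : 'cV[R]_3) (alpha beta gamma delta : R)
    (U := Umat m l alpha beta gamma) :
  S2 m -> S2 l -> dot m l = 0 -> dot n l = 0 ->
  dot m n = cos delta -> cross m n = sin delta *: l ->
  [/\ SU2 U, dot m (F U *m m) = cos beta,
      dot n (F U *m m) = cos beta * cos delta + cos alpha * sin beta * sin delta
    & dot m (F U *m n)
        = cos (- beta) * cos delta + cos gamma * sin (- beta) * sin delta].
Proof.
move=> hm hl ml nl cd lE; have [/S2P m1 /S2P l1] := (hm, hl).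
have sA := rot_SU2 alpha hm; have sB := rot_SU2 beta hl.
have sC := rot_SU2 gamma hm; have sAB := SU2_mul sA sB.
have sU : SU2 U := SU2_mul sAB sC.
have FUE : F U = F (rot m alpha) *m F (rot l beta) *m F (rot m gamma).
  by rewrite -(F_mul sA sB) -(F_mul sAB sC).
have [mm nm mn] := euler_dots m1 l1 ml nl cd lE
  (fun x => F_rot x alpha hm) (fun x => F_rot x beta hl)
  (fun x => F_rot x gamma hm) (fun x => dot_F_rot_axis x alpha hm)
  (fun x => dot_F_rot_axis x gamma hm) (F_rot_axis gamma hm).
have FU (x : 'cV[R]_3) :
    F U *m x = F (rot m alpha) *m (F (rot l beta) *m (F (rot m gamma) *m x)).
  exact: etrans (congr1 (mulmx^~ x) FUE)
    (etrans (esym (mulmxA _ _ _)) (esym (mulmxA _ _ _))).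
split; first exact: sU.
- exact: etrans (congr1 (dot m) (FU m)) mm.
- exact: etrans (congr1 (dot n) (FU m)) nm.
- exact: etrans (congr1 (dot m) (FU n)) mn.
Qed.

(** * Comparison of the three candidate lengths *)

Theorem theorem2 (R : realType) (m n : 'cV[R]_3) (hm : S2 m) (hn : S2 n)
    (hmn : 0 <= dot m n < 1) :
  let delta : R := acos (dot m n) in
  let l : 'cV[R]_3 := (norm2 (cross m n))^-1 *: cross m n in
  forall (alpha gamma beta : R), 0 <= beta <= pi ->
  let U : 'M[R[i]]_2 := Umat m l alpha beta gamma in
  b n U <= b m U ->
  N_SO3 m n (F U) = N_SU2 m n U /\
  ((N_SU2 m n U)%:Z =
     Num.min (2 * Num.ceil (beta / (2 * delta)) + 1)
       (Num.min (g alpha beta delta) (g gamma (- beta) delta)))%R.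
Proof.
move=> delta l alpha gamma beta hbeta U hb.
have [/S2P m1 /S2P n1] := (hm, hn).
have ki := dot_unit_itv m1 n1.
have d0 : 0 < delta by apply: acos_gt0; lra.
have dpi : delta < pi by apply: acos_ltpi; lra.
have c0 : norm2 (cross m n) != 0.
  by rewrite -sin_acos_dot // gt_eqF // sin_gt0_pi // d0.
have hl : S2 l.
  apply/S2P; rewrite /l dotZl dotZr mulrA -expr2.
  rewrite -[dot (cross _ _) _]sqr_sqrtr ?dot_ge0 // -/(norm2 _).
  by rewrite -exprMn mulVf // expr1n.
have [sU mm nm mn] : [/\ SU2 U, dot m (F U *m m) = cos beta,
    dot n (F U *m m) = cos beta * cos delta + cos alpha * sin beta * sin delta
  & dot m (F U *m n)
      = cos (- beta) * cos delta + cos gamma * sin (- beta) * sin delta].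
  apply: Umat_dots => //.
  - by rewrite /l dotZr cross_dotl mulr0.
  - by rewrite /l dotZr cross_dotr mulr0.
  - by rewrite acosK_itv.
  - by rewrite /l sin_acos_dot // scalerA divff // scale1r.
have nmi : -1 <= dot n (F U *m m) <= 1 by apply: dot_unit_itv; rewrite ?dot_F.
have mni : -1 <= dot m (F U *m n) <= 1 by apply: dot_unit_itv; rewrite ?dot_F.
have r1 : acos (dot m (F U *m m)) = beta by rewrite mm cosK // in_itv.
have r2 : acos (dot n (F U *m m)) = f alpha beta delta.
  by rewrite nm in nmi *; rewrite f_acos.
have r3 : acos (dot m (F U *m n)) = f gamma (- beta) delta.
  by rewrite mn in mni *; rewrite f_acos.
have eq_k x : -1 <= x <= 1 -> (x = dot m n) <-> (acos x = delta).
  move=> hx; split=> [->//|]; rewrite -{2}(acosK_itv hx) => ->.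
  by rewrite acosK_itv.
pose a e : 'cV[R]_3 := if e then n else m.
have ha e : S2 (a e) by case: e.
clearbody U.
(* The assumption on [b] as a statement about distances: $d(m,m;U)\le d(n,n;U)$. *)
have nn : dot n (F U *m n) <= dot m (F U *m m).
  have [w hw] := dot_F_b sU.
  rewrite !hw // lerD2l ler_pM2l // ler_sqr ?nnegrE ?normr_ge0 //.
have [b0 bp] := andP hbeta.
have [iA AE hA] := ceil_even_steps d0 b0.
have f0 : 0 <= f alpha beta delta by rewrite -r2 acos_ge0.
have g0 : 0 <= f gamma (- beta) delta by rewrite -r3 acos_ge0.
have [iB BE hB] := ceil_odd_steps d0 f0.
have [iC CE hC] := ceil_odd_steps d0 g0.
rewrite /g BE CE AE.
have altA i : (iA <= i)%N -> alt_word a false i.*2.+1 U.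
  rewrite -hA => h; apply: alt_word_of_dist => //=; last by case: i {h}.
  by rewrite odd_double r1.
have altB i : (iB <= i)%N -> alt_word a false i.*2.+2 U.
  move=> /hB[h h0]; apply: alt_word_of_dist => //=; rewrite ?odd_double /= ?r2 //.
  by move=> /eqP; rewrite eqSS double_eq0 => /eqP i0; apply/eq_k => //; rewrite r2 h0.
have altC i : (iC <= i)%N -> alt_word a true i.*2.+2 U.
  move=> /hC[h h0]; apply: alt_word_of_dist => //=; rewrite ?odd_double /= ?r3 //.
  by move=> /eqP; rewrite eqSS double_eq0 => /eqP i0; apply/eq_k => //; rewrite r3 h0.
(* Every alternating word is at least as long as one of the candidates $2i_A+1$, $2i_B+2$,
   $2i_C+2$. *)
have altP c j : alt_word a c j.+1 U ->
    [\/ (iA.*2 <= j)%N, (iB.*2.+1 <= j)%N | (iC.*2.+1 <= j)%N].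
  move=> h; have hd := axis_dist_le ha h; have h2 := @axis_dist_alt2 R a c U ha.
  have jE := odd_double_half j; set i := j./2 in jE.
  (* The end axes of $j+1$ alternating factors differ exactly when [j] is odd. *)
  case: (boolP (odd j)) jE hd => oj jE hd.
    have {}jE : j = i.*2.+1 by rewrite -jE.
    rewrite jE in h hd *.
    case: c h h2 hd => h h2 hd.
      apply: Or33; rewrite ltnS leq_double; apply/hC; split.
        by rewrite -r3; exact: hd.
      move=> i0; rewrite -r3; apply/eq_k; first exact: mni.
      by apply: h2; move: h; rewrite i0.
    apply: Or32; rewrite ltnS leq_double; apply/hB; split.
      by rewrite -r2; exact: hd.
    move=> i0; rewrite -r2; apply/eq_k; first exact: nmi.
    by apply: h2; move: h; rewrite i0.
  have {}jE : j = i.*2 by rewrite -jE.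
  apply: Or31; rewrite jE in hd *.
  rewrite leq_double -hA -r1.
  case: c h h2 hd => _ _ hd; last exact: hd.
  (* For type n..n, [nn] passes the bound on $d(n,n;U)$ to $d(m,m;U)$. *)
  by apply: le_trans hd; rewrite acos_le //; apply: dot_unit_itv; rewrite ?dot_F.
have [e [j [jE hj]]] : exists e j,
    j.+1 = minn iA.*2.+1 (minn iB.*2.+2 iC.*2.+2) /\ alt_word a e j.+1 U.
  rewrite /minn; case: ifP => _; [|case: ifP => _].
  - by exists false, iA.*2; split=> //; exact: altA.
  - by exists false, iB.*2.+1; split=> //; exact: altB.
  - by exists true, iC.*2.+1; split=> //; exact: altC.
have minZ (x y : nat) : Num.min x%:Z y%:Z = (minn x y)%:Z.
  by rewrite /minn /Order.min ltz_nat; case: ifP.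
have [-> ->] : N_SU2 m n U = j.+1 /\ N_SO3 m n (F U) = j.+1.
  apply: (@N_eq_alt_word R m n U e) => // c i /altP hi.
  rewrite -ltnS jE !geq_min !ltnS.
  by case: hi => ->; rewrite ?orbT.
split=> //; rewrite jE -!minZ; congr (Order.min _ _).
by rewrite -addn1 -mul2n PoszD PoszM.
Qed.
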